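(* Let $n\ge 1$, $2\le\sigma\le n$, and let $S\subseteq[\sigma]^n$ be a set of strings with $H(S)\ge n\log\sigma-\Theta(n)$. Let $Q\subseteq[\sigma]\times[n]$ be a set of queries $q_{c,p}$ whose answers lie in $[n]$, and let $U\subseteq[n]$ be a set of answers with $H(U)=O(n)$, which is $z$-unique in the sense defined below. Suppose a (deterministic) algorithm $\mathcal A$ answers every query in $Q$ on every $s\in S$ using a succinct index of $r$ bits and at most $t$ probes to $s$ per query. For any $z\in[\sigma]$, let $\lambda(z)=\min_{s\in S}\,|\mathrm{Tgt}_s(Q'_s)\cup\mathrm{Tgt}_s(Q''_s(z))|$. Then there exist integers $\gamma$ and $\delta$ with $\min\{\lambda(z),n\}/(15t)\le\gamma+\delta\le\lambda(z)$ such that $$r\ \ge\ \gamma\log\Big(\frac{\sigma}{z}\Big)+\delta\log\Big(\frac{\sigma\delta}{t|Q|}\Big)-\Theta(n).$$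
   Context: All logarithms are base 2; $[m]=\{0,1,\dots,m-1\}$; for a finite set $X$, $H(X)=\lceil\log|X|\rceil$. A string $s\in[\sigma]^n$ can only be read through $\mathrm{access}(i)$, which returns $s[i]$; each such call is a probe. A succinct index is auxiliary data of $r$ bits computed from $s$ in preprocessing (not counting the space for $s$); the query algorithm may read the index freely but reads $s$ only via probes. For a query $q_{c,p}$ and string $s$, the access pattern $\mathrm{Pat}_s(q_{c,p})\subseteq[n]$ is the set of positions probed by $\mathcal A$ when answering $q_{c,p}$ on $s$. A query $q_{c,p}$ is stumbling on $s$ if there is a computable function $f$ (fixed, independent of $s$) that on input $c,p$ and the answer of $q_{c,p}$ on $s$ outputs a position $x\in\mathrm{Pat}_s(q_{c,p})$ with $s[x]=c$; $x$ is the target of the query. $Q'_s\subseteq Q$ denotes the set of queries stumbling on $s$. A set $U$ of answers is $z$-unique if for every query $q_{c,p}$ whose answer on $s$ lies in $U$ there is a unique $i\in[p,p+z]$ with $s[i]=c$; such a query is called $z$-unique and $i$ is its target. $Q''_s(z)\subseteq Q\setminus Q'_s$ denotes the set of $z$-unique queries on $s$ that are not stumbling. $\mathrm{Tgt}_s(q)$ denotes the target of $q$ on $s$ (when defined) and $\mathrm{Tgt}_s(Q_0)=\bigcup_{q\in Q_0}\mathrm{Tgt}_s(q)$. *)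

(* Defs.v *)
From mathcomp Require Import all_boot all_order all_algebra.
From mathcomp Require Import reals exp.

Set Implicit Arguments.
Unset Strict Implicit.
Unset Printing Implicit Defensive.

Import Order.TTheory GRing.Theory Num.Theory.

Local Open Scope ring_scope.

(* Since [ln 0 = 0], [log2 0 = 0]; a summand [d * log2 (.. d ..)] vanishes at
   [d = 0], as under the usual convention [0 log 0 = 0]. *)
Definition log2 (R : realType) (x : R) : R := ln x / ln 2.

Definition H (R : realType) (T : finType) (X : {set T}) : int :=
  Num.ceil (log2 (#|X|%:R : R)).

(* The alphabet [sigma] = {0, ..., sigma - 1} and the positions [n] are the
   ordinal types, and the query q_{c,p} is the pair (c, p). *)
Notation str n sigma := {ffun 'I_n -> 'I_sigma}.
Notation query n sigma := ('I_sigma * 'I_n)%type.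

(* A deterministic adaptive computation whose only access to the string is
   through probes; the continuation receives the probed symbol. *)
Inductive probe_tree (n sigma : nat) : Type :=
| Return of 'I_n
| Probe of 'I_n & ('I_sigma -> probe_tree n sigma).

Fixpoint output n sigma (s : str n sigma) (T : probe_tree n sigma) : 'I_n :=
  match T with
  | Return a => a
  | Probe i k => output s (k (s i))
  end.

(* Probes in order, counted with multiplicity. *)
Fixpoint probes n sigma (s : str n sigma) (T : probe_tree n sigma) : seq 'I_n :=
  match T with
  | Return _ => [::]
  | Probe i k => i :: probes s (k (s i))
  end.

(* The query computation depends arbitrarily on the r index bits (they are read
   for free) but on the string only through its probes. *)
Record algorithm (n sigma r : nat) := Algorithm {
  index_of : str n sigma -> r.-tuple bool;
  query_tree : r.-tuple bool -> query n sigma -> probe_tree n sigma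
}.

Section Queries.

Variables (n sigma r : nat) (A : algorithm n sigma r).

Definition run_tree (s : str n sigma) (q : query n sigma) :=
  query_tree A (index_of A s) q.

Definition Pat (s : str n sigma) (q : query n sigma) : {set 'I_n} :=
  [set i in probes s (run_tree s q)].

(* [ans s q] is the answer prescribed for the query q on s. *)
Variable ans : str n sigma -> query n sigma -> 'I_n.

Definition answers_within (t : nat) (S : {set str n sigma})
    (Q : {set query n sigma}) : Prop :=
  forall s q, s \in S -> q \in Q ->
    output s (run_tree s q) = ans s q /\
    (size (probes s (run_tree s q)) <= t)%N.

(* The target function maps c, p and an answer to a position; [None] is for
   inputs on which it yields no position of the string.  As n and sigma are
   fixed its domain is finite, so computability is no restriction on it. *)
Variable f : 'I_sigma -> 'I_n -> 'I_n -> option 'I_n.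

Definition stumbling (s : str n sigma) (q : query n sigma) : bool :=
  if f q.1 q.2 (ans s q) is Some x then (x \in Pat s q) && (s x == q.1)
  else false.

(* i lies in [p, p + z] (cut off at the end of the string) and s[i] = c *)
Definition occurs_in_window (z : nat) (s : str n sigma) (q : query n sigma)
    (i : 'I_n) : bool :=
  (q.2 <= i <= q.2 + z)%N && (s i == q.1).

Definition z_unique_answers (z : nat) (S : {set str n sigma})
    (Q : {set query n sigma}) (U : {set 'I_n}) : Prop :=
  forall s q, s \in S -> q \in Q -> ans s q \in U ->
    exists! i : 'I_n, occurs_in_window z s q i.

Definition stumbling_queries (Q : {set query n sigma}) (s : str n sigma) :
    {set query n sigma} :=
  [set q in Q | stumbling s q].

Definition z_unique_queries (Q : {set query n sigma}) (U : {set 'I_n})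
    (s : str n sigma) : {set query n sigma} :=
  [set q in Q :\: stumbling_queries Q s | ans s q \in U].

(* When U is z-unique, [pick] has exactly one candidate. *)
Definition target (z : nat) (U : {set 'I_n}) (s : str n sigma)
    (q : query n sigma) : option 'I_n :=
  if stumbling s q then f q.1 q.2 (ans s q)
  else if ans s q \in U then [pick i | occurs_in_window z s q i]
  else None.

Definition Tgt (z : nat) (U : {set 'I_n}) (s : str n sigma)
    (Q0 : {set query n sigma}) : {set 'I_n} :=
  \bigcup_(q in Q0) [set i | target z U s q == Some i].

(* All the cardinals are at most n, so for nonempty S the default value n does
   not affect the minimum. *)
Definition lambda (S : {set str n sigma}) (Q : {set query n sigma})
    (U : {set 'I_n}) (z : nat) : nat :=
  \big[minn/n]_(s in S)
    #|Tgt z U s (stumbling_queries Q s) :|: Tgt z U s (z_unique_queries Q U s)|.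

End Queries.

(* Main.v *)
Require Import Defs.
From mathcomp Require Import all_boot all_order all_algebra.
From mathcomp Require Import reals exp.
From mathcomp Require Import ring lra.

Set Implicit Arguments.
Unset Strict Implicit.
Unset Printing Implicit Defensive.

Import Order.TTheory GRing.Theory Num.Theory.

Local Open Scope ring_scope.

(* A string s of S is encoded by far fewer than n log sigma bits beyond the
   index. Choose lambda targets of s with a query for each; as a query probes at
   most t positions, at least lambda / (2t + 1) of these targets form a set E no
   element of which is probed by the query of another. Erase s on E.
   - An erased position probed by its own query is recovered from the set of
     these queries, a subset of Q: in the run of such a query (c, p) the first
     erased position probed is its target, which holds c.
   - For an erased position x not probed by its own query, the decoder lists the
     symbols c for which some query (c, p) with p <= x <= p + z runs without
     touching E and has its answer in U. By z-uniqueness each of them occurs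
     within distance z of x, so there are at most 2z + 1, and s[x] is one of
     them; its rank in the list costs log z + O(1) bits. *)

(** * Runs of a probe tree on two strings that agree outside a set *)

Lemma agree_probes n sigma (s s' : str n sigma) (T : probe_tree n sigma) :
  {in probes s T, s =1 s'} -> probes s' T = probes s T.
Proof.
elim: T => [//|i k IH] /= eqss'.
have -> : s' i = s i by rewrite eqss' ?mem_head.
by rewrite IH // => j js; rewrite eqss' // inE js orbT.
Qed.

Lemma agree_output n sigma (s s' : str n sigma) (T : probe_tree n sigma) :
  {in probes s T, s =1 s'} -> output s' T = output s T.
Proof.
elim: T => [//|i k IH] /= eqss'.
have -> : s' i = s i by rewrite eqss' ?mem_head.
by rewrite IH // => j js; rewrite eqss' // inE js orbT.
Qed.

(** Until a run meets [E] it reads only symbols shared by [s] and [s'], so both runs follow the same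
    path and reach [E] first at the same position. That position is [x] by the first condition and
    [x'] by the second. *)
Lemma same_first_probe n sigma (s s' : str n sigma) (E : {set 'I_n}) x x'
    (T : probe_tree n sigma) :
  {in ~: E, s =1 s'} ->
  {in probes s T, forall i, i \in E -> i = x} ->
  {in probes s' T, forall i, i \in E -> i = x'} ->
  x \in E -> x \in probes s T -> x = x'.
Proof.
move=> eqss' + + xE; elim: T => [//|i k IH] /= ex ex'.
case: (boolP (i \in E)) => [iE _|iNE].
  by rewrite -(ex i) ?mem_head // -(ex' i) ?mem_head.
have eqi : s' i = s i by rewrite eqss' // inE.
rewrite inE => /orP[/eqP xi|xk]; first by rewrite -xi xE in iNE.
rewrite eqi in ex'.
by apply: (IH (s i)) => // j jk; [apply: ex | apply: ex']; rewrite inE jk orbT.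
Qed.

(** * Combinatorial bounds *)

(* Since out-degrees are at most [t], some vertex also has in-degree at most
   [t]: keep it, discard its neighbours, and iterate. *)
Lemma independent_subset (V : finType) (e : V -> {set V}) (t : nat)
    (T : {set V}) :
  {in T, forall y, (#|e y| <= t)%N} ->
  exists2 E : {set V}, E \subset T &
    (#|T| <= (2 * t).+1 * #|E|)%N /\
    {in E &, forall x y, x \in e y -> x = y}.
Proof.
have [k] := ubnP #|T|; elim: k T => // k IH T /ltnSE leTk et.
have [->|[y0 y0T]] := set_0Vmem T.
  by exists set0; rewrite ?sub0set // cards0; split => // x y; rewrite inE.
have [y yT ley] : exists2 y, y \in T & (#|[set x in T | y \in e x]| <= t)%N.
  apply/exists_inP/contraT; rewrite negb_exists_in => /forall_inP lty.
  suff : (\sum_(y in T) #|[set x in T | y \in e x]| <= \sum_(y in T) t)%N.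
    (* Splitting off [y0] makes the inequality strict; this is where [T] must be nonempty. *)
    rewrite leqNgt => /negP[]; rewrite [X in (_ < X)%N](bigD1 y0) //=.
    rewrite [X in (X < _)%N](bigD1 y0) //= -addSn leq_add //.
      by rewrite ltnNge lty.
    by apply: leq_sum => y /andP[/lty]; rewrite -ltnNge => /ltnW.
  (* Double counting: summed over [T], the in-degrees count each edge once, and so do the
     out-degrees into [T]. *)
  under eq_bigr do rewrite -sum1_card big_mkcond.
  rewrite exchange_big big_mkcond [X in (_ <= X)%N]big_mkcond /=.
  apply: leq_sum => x _; case: ifPn => xT; last first.
    by rewrite big1 // => y _; rewrite inE (negPf xT).
  rewrite -big_mkcondr /=; apply: leq_trans (et x xT).
  rewrite -sum1_card big_mkcond [X in (_ <= X)%N]big_mkcond /=.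
  apply: leq_sum => y _; rewrite inE xT.
  by case: (y \in T); case: (y \in e x).
pose N := y |: (e y :|: [set x in T | y \in e x]).
have leN : (#|N| <= (2 * t).+1)%N.
  rewrite (leq_trans (leq_card_setU _ _)) // cards1 add1n ltnS mul2n -addnn.
  by rewrite (leq_trans (leq_card_setU _ _)) // leq_add // et.
have ltk : (#|T :\: N| < k)%N.
  apply: leq_trans leTk; apply: proper_card; apply/properP.
  split; first exact: subsetDl.
  by exists y => //; rewrite !inE eqxx.
have [|E ET [leE indE]] := IH _ ltk.
  by move=> x /setDP[xT _]; apply: et.
have ETN x : x \in E -> (x \in T) && (x \notin N).
  by move=> /(subsetP ET)/setDP[-> ->].
have yNE : y \notin E.
  by apply/negP => /ETN/andP[_]; rewrite !inE eqxx.
exists (y |: E).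
  by apply/subsetP => x; rewrite !inE => /orP[/eqP->//|/ETN/andP[]].
split.
  rewrite cardsU1 yNE mulnDr muln1 -(cardsID N T) leq_add //.
  by rewrite (leq_trans _ leN) // subset_leq_card // subsetIr.
move=> u v; rewrite !inE => /orP[/eqP->|uE] /orP[/eqP->|vE] //.
- move: (ETN _ vE) => /andP[vT]; rewrite !inE vT /= => /norP[_ /norP[_ /negP//]].
- by move: (ETN _ uE) => /andP[uT]; rewrite !inE => /norP[_ /norP[/negP + _]].
- exact: indE.
Qed.

(* [d ^ d / d`! <= 'C(2d, d) <= 2 ^ (2d)] *)
Lemma leq_expnn_fact (d : nat) : (d ^ d <= 4 ^ d * d`!)%N.
Proof.
have le_ffact k : (d ^ k <= (d + k) ^_ k)%N.
  elim: k => // k IH; rewrite addnS ffactnS expnS leq_mul //.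
  by rewrite leqW // leq_addr.
apply: leq_trans (le_ffact d) _; rewrite -bin_ffact leq_mul2r orbC.
apply/orP; left; rewrite -[4%N]/(2 ^ 2)%N -expnM mul2n -addnn.
have ltd : (d < (d + d).+1)%N by rewrite ltnS leq_addr.
have := expnDn 1 1 (d + d); rewrite addnn -addnn => ->.
rewrite (bigD1 (Ordinal ltd)) //= !exp1n !muln1.
exact: leq_addr.
Qed.

(** This is ['C(q, d) <= (4q/d)^d] without division, hence meaningful at [d = 0]. It bounds the cost
    of naming a set of [d] queries. *)
Lemma leq_bin_expn (q d : nat) : (d ^ d * 'C(q, d) <= 4 ^ d * q ^ d)%N.
Proof.
apply: leq_trans (_ : 4 ^ d * d`! * 'C(q, d) <= _)%N.
  by rewrite leq_mul2r leq_expnn_fact orbT.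
rewrite -mulnA leq_mul2l mulnC bin_ffact.
apply/orP; right; elim: d q => // d IH [|q]; first by rewrite ffact0n.
rewrite ffactSS expnS leq_mul // (leq_trans (IH q)) //.
by case: d {IH} => // d; rewrite leq_exp2r.
Qed.

Lemma bigminn_le (I : finType) (P : pred I) (F : I -> nat) m i :
  P i -> (\big[minn/m]_(j | P j) F j <= F i)%N.
Proof.
move=> Pi; move: (mem_index_enum i); elim: (index_enum I) => // j e IH.
rewrite inE big_cons => /orP[/eqP <-|/IH le]; first by rewrite Pi geq_minl.
by case: ifP => // _; rewrite geq_min le orbT.
Qed.

(** * Encoding and decoding the strings *)

Section Encoding.

Variables (n sigma r : nat) (A : algorithm n sigma r).
Variable ans : str n sigma -> query n sigma -> 'I_n.
Variables (f : 'I_sigma -> 'I_n -> 'I_n -> option 'I_n).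
Variables (t z : nat) (S : {set str n sigma}) (Q : {set query n sigma}).
Variable U : {set 'I_n}.
Hypothesis A_correct : answers_within A ans t S Q.
Hypothesis U_unique : z_unique_answers ans z S Q U.

(* [E = G :|: D] is erased; [G] and [D] are the targets counted by gamma and by
   delta, i.e. those not probed, resp. probed, by their own query. *)
Definition decodable (s : str n sigma) (G D : {set 'I_n})
    (g : 'I_n -> query n sigma) : bool :=
  [&& [forall x in G :|: D, (g x \in Q) && (s x == (g x).1)],
      [forall x in D, (x \in Pat A s (g x)) &&
         (Pat A s (g x) :&: (G :|: D) \subset [set x])] &
      [forall x in G, [&& [disjoint Pat A s (g x) & G :|: D], ans s (g x) \in U &
         ((g x).2 <= x <= (g x).2 + z)%N]]].

Lemma decodable_exists (s : str n sigma) : (0 < t)%N -> s \in S ->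
  exists G D : {set 'I_n}, exists g : {ffun 'I_n -> query n sigma},
    [/\ [disjoint G & D], (lambda A ans f S Q U z <= 15 * t * #|G :|: D|)%N,
        (#|G :|: D| <= lambda A ans f S Q U z)%N & decodable s G D g].
Proof.
move=> t_gt0 sS; set l := lambda _ _ _ _ _ _ _.
set W := Tgt A ans f z U s (stumbling_queries A ans f Q s) :|:
         Tgt A ans f z U s (z_unique_queries A ans f Q U s).
have leW : (l <= #|W|)%N by apply: bigminn_le.
have [T TW cardT] : exists2 T : {set 'I_n}, T \subset W & #|T| = l.
  have [T] : {T : {set 'I_n} | T \subset W & #|T| == l}.
    apply: sig2W; have : (0 < #|[set B : {set 'I_n} | B \subset W & #|B| == l]|)%N.
      by rewrite cards_draws bin_gt0.
    by case/card_gt0P => B; rewrite inE => /andP[]; exists B.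
  by move=> TW /eqP; exists T.
(* A stumbling target satisfies the first alternative, a z-unique target the second. *)
pose good x q := [&& q \in Q, s x == q.1 &
  (x \in Pat A s q) || (ans s q \in U) && (q.2 <= x <= q.2 + z)%N].
have Wgood x : x \in W -> exists q, good x q.
  rewrite inE => /orP[] /bigcupP[q]; rewrite !inE.
    move=> /andP[qQ st]; rewrite /target st => /eqP fq; exists q.
    by move: st; rewrite /stumbling fq /good qQ => /andP[-> ->].
  move=> /andP[/andP[st qQ] aU]; rewrite qQ /= in st.
  rewrite /target (negPf st) aU.
  case: pickP => // i /andP[wi /eqP si] /eqP[<-]; exists q.
  by rewrite /good qQ si eqxx aU wi orbT.
have /fin_all_exists[g gP] x : exists q, x \in W -> good x q.
  by case: (boolP (x \in W)) => [/Wgood[q]|_]; [exists q | exists (s x, x)].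
have gT x : x \in T -> good x (g x) by move=> /(subsetP TW); apply: gP.
have cardPat : {in T, forall x, (#|Pat A s (g x)| <= t)%N}.
  move=> x /gT/and3P[xQ _ _]; rewrite cardsE (leq_trans (card_size _)) //.
  by case: (A_correct sS xQ).
have [E ET [leE indE]] := independent_subset cardPat.
pose D := [set x in E | x \in Pat A s (g x)].
have EGD : E :\: D :|: D = E.
  by apply/setP => x; rewrite !inE; case: (x \in E); rewrite ?andbF //= andbT orNb.
exists (E :\: D), D, [ffun x => g x]; rewrite EGD; split.
- by rewrite -setI_eq0 setIDAC -setIDA setDv setI0.
- rewrite -cardT (leq_trans leE) // leq_mul2r; apply/orP; right.
  (* [2 * t + 1 <= 15 * t] because [t] is positive. *)
  by rewrite -[15%N]/(2 + 13)%N mulnDl -addn1 leq_add2l muln_gt0.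
- by rewrite -cardT subset_leq_card.
have gE x : x \in E -> good x (g x) by move=> /(subsetP ET)/gT.
rewrite /decodable EGD; apply/and3P; split; apply/forall_inP => x; rewrite ffunE.
- by case/gE/and3P => -> ->.
- rewrite inE => /andP[xE ->] /=; apply/subsetP => y /setIP[yP yE].
  by rewrite inE (indE y x).
rewrite inE => /andP[xND xE].
have xNP : x \notin Pat A s (g x) by apply: contra xND => xP; rewrite inE xE.
case/gE/and3P: (xE) => _ _; rewrite (negPf xNP) /= => /andP[-> ->].
rewrite !andbT -setI_eq0 -subset0; apply/subsetP => y /setIP[yP yE].
by move: (yP); rewrite (indE y x yE xE yP) (negPf xNP).
Qed.

(** All of [Q] is searched, since the decoder does not know the queries chosen for the targets.
    Disjointness from [E] keeps the runs away from erased symbols, so the decoder can simulate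
    them. *)
Definition local_symbols (s : str n sigma) (E : {set 'I_n}) (x : 'I_n) :
    {set 'I_sigma} :=
  [set c | [exists p : 'I_n, [&& (c, p) \in Q, [disjoint Pat A s (c, p) & E],
     ans s (c, p) \in U & (p <= x <= p + z)%N]]].

Lemma card_local_symbols s E x : s \in S ->
  (#|local_symbols s E x| <= (2 * z).+1)%N.
Proof.
move=> sS; pose near := [set i : 'I_n | (x <= i + z)%N && (i <= x + z)%N].
have lenear : (#|near| <= (2 * z).+1)%N.
  rewrite -[X in (_ <= X)%N]card_ord.
  (* The shift by [z] keeps the truncated subtraction exact on [near]. *)
  pose h (i : 'I_n) : 'I_(2 * z).+1 := inord (i + z - x).
  rewrite -(@card_in_imset _ _ h near) ?max_card // => i j.
  rewrite !inE => /andP[i1 i2] /andP[j1 j2] /(congr1 val) /=.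
  rewrite !inordK ?ltnS ?leq_subLR ?mul2n -?addnn ?addnA ?leq_add2r // => eqh.
  apply/val_inj/(@addIn z) => /=.
  by rewrite -(subnK i1) -(subnK j1) eqh.
apply: leq_trans lenear; apply: leq_trans (leq_imset_card s near).
apply/subset_leq_card/subsetP => c; rewrite inE => /existsP[p].
move=> /and4P[pQ _ pU /andP[px xp]].
have [i [/andP[/andP[/= pi ip] /eqP <-] _]] := U_unique sS pQ pU.
apply: imset_f; rewrite inE (leq_trans xp) ?leq_add2r //=.
by rewrite (leq_trans ip) // leq_add2r.
Qed.

Lemma agree_query s s' (E : {set 'I_n}) q :
  s \in S -> s' \in S -> q \in Q -> index_of A s = index_of A s' ->
  {in ~: E, s =1 s'} -> [disjoint Pat A s q & E] ->
  Pat A s' q = Pat A s q /\ ans s' q = ans s q.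
Proof.
move=> sS s'S qQ eqA eqss' dis.
have eqpr : {in probes s (run_tree A s q), s =1 s'}.
  by move=> i ip; apply: eqss'; rewrite inE (disjointFr dis) // inE.
rewrite -(A_correct sS qQ).1 -(A_correct s'S qQ).1 /Pat /run_tree -eqA.
by rewrite (agree_probes eqpr) (agree_output eqpr).
Qed.

Lemma agree_local_symbols s s' E x :
  s \in S -> s' \in S -> index_of A s = index_of A s' ->
  {in ~: E, s =1 s'} -> local_symbols s E x = local_symbols s' E x.
Proof.
have sub u v : u \in S -> v \in S -> index_of A u = index_of A v ->
    {in ~: E, u =1 v} -> local_symbols u E x \subset local_symbols v E x.
  move=> uS vS eqA equv; apply/subsetP => c; rewrite !inE => /existsP[p].
  move=> /and4P[pQ dis pU win]; apply/existsP; exists p.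
  by have [-> ->] := agree_query uS vS pQ eqA equv dis; rewrite pQ dis pU.
move=> sS s'S eqA eqss'; apply/eqP; rewrite eqEsubset !sub //.
by move=> i iE; rewrite eqss'.
Qed.

(** The factors count, in order, the index, the symbols outside [G :|: D], the set of queries chosen
    for [D], and the ranks on [G]. The pair [(G, D)] is fixed here; [card_strings_le] pays for
    it. *)
Lemma card_decodable (c0 : 'I_sigma) (G D : {set 'I_n}) :
  (#|[set s in S | [exists g : {ffun 'I_n -> query n sigma}, decodable s G D g]]|
   <= 2 ^ r * sigma ^ (n - #|G :|: D|) * 'C(#|Q|, #|D|) * (2 * z).+1 ^ #|G|)%N.
Proof.
set E := G :|: D; set X := [set s in S | _].
have /fin_all_exists[g gP] s : exists g : {ffun 'I_n -> query n sigma},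
    s \in X -> decodable s G D g.
  case: (boolP (s \in X)) => [|_]; last by exists [ffun x => (s x, x)].
  by rewrite inE => /andP[_ /existsP[g ?]]; exists g.
have XS s : s \in X -> s \in S by rewrite inE => /andP[].
pose rank (s : str n sigma) x := index (s x) (enum (local_symbols s E x)).
pose code (s : str n sigma) := (index_of A s, [ffun x => if x \in E then c0 else s x],
  g s @: D, [ffun x => if x \in G then inord (rank s x) else ord0 : 'I_(2 * z).+1]).
have sym s x : s \in X -> x \in G -> s x \in local_symbols s E x.
  move=> sX xG; have /and3P[/forall_inP H1 _ /forall_inP/(_ x xG)] := gP s sX.
  move=> /and3P[dis aU win].
  have /andP[gQ /eqP ->] : (g s x \in Q) && (s x == (g s x).1).
    by apply: H1; rewrite inE xG.
  by rewrite inE; apply/existsP; exists (g s x).2; rewrite -surjective_pairing gQ dis aU.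
have injcode : {in X &, injective code}.
  move=> s s' sX s'X [eqA /ffunP eqoff eqD /ffunP eqG].
  have eqss' : {in ~: E, s =1 s'}.
    by move=> x; rewrite inE => /negPf xE; have := eqoff x; rewrite !ffunE xE.
  apply/ffunP => x; have [xE|xE] := boolP (x \in E); last by rewrite eqss' ?in_setC.
  move: (xE); rewrite inE => /orP[] xG.
    have := eqG x; rewrite !ffunE xG => /(congr1 val).
    (* The rank takes at most [(2 * z).+1] values, so [inord] loses nothing. *)
    have rlt u : u \in X -> (rank u x < (2 * z).+1)%N.
      move=> uX; apply: leq_trans (card_local_symbols E x (XS u uX)).
      by rewrite cardE index_mem mem_enum sym.
    rewrite /= !inordK ?rlt // /rank.
    rewrite (agree_local_symbols x (XS _ sX) (XS _ s'X) eqA eqss').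
    move=> eqr; have := nth_index c0 (_ : s x \in enum (local_symbols s' E x)).
    rewrite eqr nth_index ?mem_enum ?sym // => -> //.
    by rewrite -(agree_local_symbols x (XS _ sX) (XS _ s'X) eqA eqss') sym.
  (* Only the set of queries is stored, so the query of [x] for [s] is a priori that of another
     position [y] for [s']; the first erased probe shows [x = y]. *)
  have /imsetP[y yD gxy] : g s x \in g s' @: D by rewrite -eqD imset_f.
  have /and3P[/forall_inP H1 /forall_inP/(_ x xG)/andP[xP /subsetP xE1] _] := gP s sX.
  have /and3P[/forall_inP H1' /forall_inP/(_ y yD)/andP[yP /subsetP yE1] _] := gP s' s'X.
  have xy : x = y.
    apply: (@same_first_probe _ _ s s' E x y (run_tree A s (g s x))) => //.
    - by move=> i iP iE; apply/set1P/xE1/setIP; rewrite inE.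
    - by move=> i iP iE; apply/set1P/yE1/setIP; rewrite inE -gxy /run_tree -eqA.
    - by move: xP; rewrite inE.
  have /andP[_ /eqP ->] := H1 x xE.
  have yE : y \in E by rewrite -xy.
  by have /andP[_ /eqP] := H1' y yE; rewrite -gxy -xy.
rewrite -(card_in_imset injcode).
pose codes := setX (setX (setX [set: r.-tuple bool]
  [set h in pffun_on c0 (~: E) predT]) [set B : {set query n sigma} | B \subset Q & #|B| == #|D|])
  [set h in pffun_on (ord0 : 'I_(2 * z).+1) G predT].
have -> : (2 ^ r * sigma ^ (n - #|E|) * 'C(#|Q|, #|D|) * (2 * z).+1 ^ #|G| = #|codes|)%N.
  have <- : #|~: E| = (n - #|E|)%N by rewrite cardsCs setCK card_ord.
  have card_on (Z : finType) (c : Z) (B : {set 'I_n}) :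
      #|[set h in pffun_on c B (predT : pred Z)]| = (#|Z| ^ #|B|)%N.
    by rewrite cardsE card_pffun_on.
  rewrite !cardsX cardsT card_tuple card_bool cards_draws !card_on.
  by rewrite !card_ord.
apply/subset_leq_card/subsetP => _ /imsetP[s sX ->].
have /and3P[/forall_inP H1 /forall_inP H2 _] := gP s sX.
rewrite !inE /=; apply/andP; split; first (apply/andP; split).
- apply/pffun_onP; split => [|//]; apply/subsetP => x; rewrite supportE ffunE in_setC.
  by case: (x \in E); rewrite ?eqxx.
- apply/andP; split.
    by apply/subsetP => _ /imsetP[x xD ->]; have /andP[] := H1 x (subsetP (subsetUr G D) x xD).
  (* Distinct positions of [D] have distinct queries: a query shared by [x] and [y] probes [x], yet
     [y] is the only erased position it probes. *)
  apply/eqP/card_in_imset => x y xD yD gxy.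
  have /andP[xP _] := H2 x xD; have /andP[_ /subsetP yE] := H2 y yD.
  by apply/set1P/yE; rewrite -gxy !inE xD orbT andbT; move: xP; rewrite inE.
apply/pffun_onP; split => [|//]; apply/subsetP => x; rewrite supportE ffunE.
by case: (x \in G); rewrite ?eqxx.
Qed.

(** Pigeonhole: each string of [S] is decodable for one of at most [4 ^ n] pairs [(G, D)], so a most
    frequent pair covers a fraction [4 ^ - n] of [S]. Its cardinals serve as [gamma] and [delta]. *)
Lemma card_strings_le (c0 : 'I_sigma) : (0 < t)%N -> (0 < z)%N -> S != set0 ->
  let l := lambda A ans f S Q U z in
  exists gamma delta : nat,
    [/\ (l <= 15 * t * (gamma + delta))%N, (gamma + delta <= l)%N &
      (#|S| * delta ^ delta * sigma ^ (gamma + delta)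
        <= 2 ^ (4 * n + r) * sigma ^ n * #|Q| ^ delta * z ^ gamma)%N].
Proof.
move=> t_gt0 z_gt0 /set0Pn[s0 s0S] l.
pose valid (p : {set 'I_n} * {set 'I_n}) := [&& [disjoint p.1 & p.2],
  (l <= 15 * t * #|p.1 :|: p.2|)%N & (#|p.1 :|: p.2| <= l)%N].
pose X (p : {set 'I_n} * {set 'I_n}) := [set s in S |
  [exists g : {ffun 'I_n -> query n sigma}, decodable s p.1 p.2 g]].
have validS s : s \in S -> exists2 p, valid p & s \in X p.
  move=> sS; have [G [D [g [dis le1 le2 dec]]]] := decodable_exists t_gt0 sS.
  exists (G, D); first by rewrite /valid dis le1.
  by rewrite inE sS; apply/existsP; exists g.
have [p0 p0v _] := validS s0 s0S.
case: (arg_maxnP (fun p => #|X p|) p0v) => -[G D] /and3P[/= dis le1 le2] maxGD.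
have leS : (#|S| <= 4 ^ n * #|X (G, D)|)%N.
  apply: (@leq_trans (\sum_(p | valid p) #|X p|)).
    apply: (@leq_trans #|\bigcup_(p | valid p) X p|).
      apply/subset_leq_card/subsetP => s /validS[p vp sp].
      by apply/bigcupP; exists p.
    elim/big_rec2: _ => [|p k B _ IH]; first by rewrite cards0.
    by rewrite (leq_trans (leq_card_setU _ _)) // leq_add2l.
  apply: (@leq_trans (\sum_(p : {set 'I_n} * {set 'I_n}) #|X (G, D)|)).
    by rewrite big_mkcond leq_sum //= => p _; case: ifP => // /maxGD.
  rewrite sum_nat_const card_prod -!cardsT -powersetT card_powerset cardsT.
  by rewrite card_ord -expnMn.
have cardGD : #|G :|: D| = (#|G| + #|D|)%N.
  by have := leq_card_setU G D; rewrite dis => /leqifP/eqP.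
exists #|G|, #|D|; rewrite -cardGD; split=> //.
have len : (#|G :|: D| <= n)%N by rewrite -[X in (_ <= X)%N]card_ord max_card.
have cardX := card_decodable c0 G D.
(* The powers of 4 come from the pairs, from [leq_bin_expn], and from [2 * z + 1 <= 4 * z]; as
   [#|G| + #|D| <= n], they total at most [4 ^ (2 * n)]. *)
have [sn dg] : (sigma ^ n)%N = (sigma ^ (n - #|G :|: D|) * sigma ^ #|G :|: D|)%N /\
    (4 ^ n * (4 ^ #|D| * 4 ^ #|G|) <= 2 ^ (4 * n))%N.
  rewrite -expnD subnK // -[(4 * n)%N]/((2 * 2) * n)%N -mulnA expnM mul2n -addnn.
  by rewrite expnD leq_mul2l -expnD leq_exp2l // addnC -cardGD len orbT.
have le2z : ((2 * z).+1 ^ #|G| <= 4 ^ #|G| * z ^ #|G|)%N.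
  rewrite -expnMn; case: #|G| => // k; rewrite leq_exp2r // -addn1.
  by rewrite -[4%N]/(2 + 2)%N mulnDl leq_add2l muln_gt0.
set e := #|G :|: D| in cardX sn *.
have ss : (#|S| <= 4 ^ n *
    (2 ^ r * sigma ^ (n - e) * 'C(#|Q|, #|D|) * (2 * z).+1 ^ #|G|))%N.
  by apply: leq_trans leS _; rewrite leq_mul2l cardX orbT.
apply: (@leq_trans (4 ^ n * 2 ^ r * sigma ^ n * (#|D| ^ #|D| * 'C(#|Q|, #|D|))
                     * (2 * z).+1 ^ #|G|)).
  rewrite -mulnA (leq_trans (leq_mul ss (leqnn _))) // sn.
  by apply: eq_leq; ring.
apply: leq_trans (leq_mul (leq_mul (leqnn _) (leq_bin_expn _ _)) le2z) _.
rewrite expnD; apply: leq_trans (leq_mul (leq_mul (leq_mul (leq_mul dg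
  (leqnn (2 ^ r))) (leqnn (sigma ^ n))) (leqnn (#|Q| ^ #|D|))) (leqnn (z ^ #|G|))).
by apply: eq_leq; ring.
Qed.

End Encoding.

(** * Logarithms in base 2 *)

Lemma log2M (R : realType) (x y : R) : 0 < x -> 0 < y ->
  log2 (x * y) = log2 x + log2 y.
Proof. by move=> x0 y0; rewrite /log2 lnM ?posrE // mulrDl. Qed.

Lemma log2V (R : realType) (x : R) : 0 < x -> log2 x^-1 = - log2 x.
Proof. by move=> x0; rewrite /log2 lnV ?posrE // mulNr. Qed.

Lemma ln2_gt0 (R : realType) : 0 < ln 2 :> R.
Proof. by rewrite ln_gt0 // ltr1n. Qed.

Lemma log2_natX (R : realType) (m k : nat) : (0 < m ^ k)%N ->
  log2 (m ^ k)%:R = k%:R * log2 (m%:R : R).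
Proof.
rewrite expn_gt0 natrX => /orP[m0|/eqP->]; last by rewrite mul0r /log2 ln1 mul0r.
by rewrite /log2 lnXn ?ltr0n // -[_ *+ k]mulr_natl mulrA.
Qed.

Lemma log2_natM (R : realType) (m k : nat) : (0 < m)%N -> (0 < k)%N ->
  log2 (m * k)%:R = log2 m%:R + log2 k%:R :> R.
Proof. by move=> m0 k0; rewrite natrM log2M ?ltr0n. Qed.

Lemma log2_le (R : realType) (x y : R) : 0 < x -> x <= y -> log2 x <= log2 y.
Proof.
move=> x0 xy; rewrite /log2 ler_pM2r ?invr_gt0 ?ln2_gt0 //.
by rewrite ler_ln ?posrE // (lt_le_trans x0).
Qed.

(** * From the counting bound to the lower bound on the index *)

Theorem theorem1 (R : realType) (CS CU : R) :
  exists2 C : R, 0 < C &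
  forall (n sigma : nat), (1 <= n)%N -> (2 <= sigma <= n)%N ->
  forall (S : {set str n sigma}), S != set0 ->
    n%:R * log2 (sigma%:R : R) - CS * n%:R <= (H R S)%:~R ->
  forall (Q : {set query n sigma}) (ans : str n sigma -> query n sigma -> 'I_n)
    (U : {set 'I_n}), (H R U)%:~R <= CU * n%:R ->
  forall (f : 'I_sigma -> 'I_n -> 'I_n -> option 'I_n),
  forall (r t : nat) (A : algorithm n sigma r), (0 < t)%N ->
    answers_within A ans t S Q ->
  forall z : nat, (0 < z < sigma)%N ->
    z_unique_answers ans z S Q U ->
  exists gamma delta : nat,
    [/\ (minn (lambda A ans f S Q U z) n)%:R / (15 * t)%:R
          <= (gamma + delta)%:R :> R,
        (gamma + delta <= lambda A ans f S Q U z)%N &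
        gamma%:R * log2 (sigma%:R / z%:R)
          + delta%:R * log2 ((sigma * delta)%:R / (t * #|Q|)%:R)
          - C * n%:R <= (r%:R : R)].
Proof.
(* Here 4 comes from the factor [2 ^ (4 * n)], 1 from the ceiling in [H] (as [1 <= n]), and [CS]
   from the size of [S]. *)
exists (`|CS| + 5); first by rewrite ltr_wpDl.
move=> n sigma n_gt0 /andP[sigma_ge2 _] S S0 leH Q ans U _ f r t A t_gt0 Aok z.
move=> /andP[z_gt0 _] Uok.
have sigma_gt0 : (0 < sigma)%N by apply: leq_trans sigma_ge2.
have [g [d [le1 le2 leS]]] :=
  card_strings_le f Aok Uok (Ordinal sigma_gt0) t_gt0 z_gt0 S0.
exists g, d; split => //.
  rewrite ler_pdivrMr ?ltr0n ?muln_gt0 // -natrM ler_nat mulnC.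
  by rewrite (leq_trans (geq_minl _ _)).
have S_gt0 : (0 < #|S|)%N by rewrite card_gt0.
have dd_gt0 : (0 < d ^ d)%N by case: d {le1 le2 leS} => // d; rewrite expn_gt0.
have lhs_gt0 : (0 < #|S| * d ^ d * sigma ^ (g + d))%N.
  by rewrite !muln_gt0 S_gt0 dd_gt0 expn_gt0 sigma_gt0.
(* If this power were 0, the right side of [leS] would vanish; so an empty [Q] forces [d = 0]. *)
have Qd_gt0 : (0 < #|Q| ^ d)%N.
  by have := leq_trans lhs_gt0 leS; rewrite !muln_gt0 => /andP[/andP[]].
have log_leS : log2 (#|S|%:R : R) + d%:R * log2 d%:R + (g%:R + d%:R) * log2 sigma%:R
    <= 4 * n%:R + r%:R + n%:R * log2 sigma%:R + d%:R * log2 #|Q|%:R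
       + g%:R * log2 z%:R.
  have log22 : log2 2%:R = 1 :> R by rewrite /log2 divff ?gt_eqF ?ln2_gt0.
  have p2 : (0 < 2 ^ (4 * n + r))%N by rewrite expn_gt0.
  have psigma k : (0 < sigma ^ k)%N by rewrite expn_gt0 sigma_gt0.
  have pz : (0 < z ^ g)%N by rewrite expn_gt0 z_gt0.
  have : log2 (#|S| * d ^ d * sigma ^ (g + d))%:R
      <= log2 (2 ^ (4 * n + r) * sigma ^ n * #|Q| ^ d * z ^ g)%:R :> R.
    by apply: log2_le; rewrite ?ltr0n ?ler_nat.
  rewrite !log2_natM ?muln_gt0 ?S_gt0 ?p2 ?psigma ?Qd_gt0 //.
  rewrite !log2_natX // log22 mulr1.
  by rewrite (natrD _ (4 * n)) (natrD _ g) natrM.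
have log_leH : n%:R * log2 sigma%:R - CS * n%:R <= log2 (#|S|%:R : R) + 1.
  apply: le_trans leH _; rewrite -lerBlDr.
  by have := ltW (ceilB1_lt (log2 (#|S|%:R : R))); rewrite intrB.
(* The case [d = 0] is separate, its logarithms being default values. Otherwise [log2 t >= 0], so
   the [t] in the denominator only lowers the left side. *)
have log_d : d%:R * log2 ((sigma * d)%:R / (t * #|Q|)%:R)
    <= d%:R * (log2 sigma%:R + log2 d%:R - log2 #|Q|%:R) :> R.
  case: d Qd_gt0 {le1 le2 leS dd_gt0 lhs_gt0 log_leS} => [|d] Qd_gt0.
    by rewrite !mul0r.
  have Q_gt0 : (0 < #|Q|)%N by move: Qd_gt0; rewrite expn_gt0 orbF.
  rewrite ler_wpM2l // log2M ?invr_gt0 ?ltr0n ?muln_gt0 ?sigma_gt0 ?t_gt0 //.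
  rewrite log2V ?ltr0n ?muln_gt0 ?t_gt0 // !log2_natM //.
  have : 0 <= log2 (t%:R : R).
    by rewrite divr_ge0 ?ln_ge0 ?ler1n // ltW ?ln2_gt0.
  lra.
have leCS : CS * n%:R <= `|CS| * n%:R by rewrite ler_wpM2r ?ler_norm.
have n1 : 1 <= n%:R :> R by rewrite ler1n.
have -> : log2 (sigma%:R / z%:R) = log2 sigma%:R - log2 z%:R :> R.
  by rewrite log2M ?invr_gt0 ?ltr0n // log2V ?ltr0n.
lra.
Qed.
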